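(* If $\mathcal C$ has the packing property and $I=I(\mathcal C)$, then $I^2=\overline{I^2}$.
   Context: Let $R=K[x_1,\ldots,x_n]$ be a polynomial ring over a field $K$. A clutter on a vertex set is a family of subsets (edges), none included in another. $\mathcal C$ is a clutter with vertex set $X=\{x_1,\ldots,x_n\}$ and $I=I(\mathcal C)\subset R$ is its edge ideal, minimally generated by the square-free monomials $\prod_{x_i\in S}x_i$, $S$ an edge of $\mathcal C$. Standing assumptions: $I$ has height $g\ge 2$, the generators have degree at least two, and each variable $x_i$ divides at least one generator. $\overline{I^2}$ denotes the integral closure of $I^2$ in $R$. For disjoint sets $Y,Z\subset X$, let $I'$ be the ideal of $R'=K[X\setminus(Y\cup Z)]$ obtained from $I$ by making all variables of $Y$ equal to $0$ and all variables of $Z$ equal to $1$; when $(0)\subsetneq I'\subsetneq R'$, the clutter whose edges are the supports of the minimal monomial generators of $I'$ is called a minor of $\mathcal C$ ($\mathcal C$ itself is a minor). For a clutter $\mathcal C'$, $\alpha_0(\mathcal C')$ is the minimum cardinality of a vertex cover (a set of vertices meeting every edge), and $\beta_1(\mathcal C')$ is the maximum number of pairwise disjoint edges. $\mathcal C$ has the packing property if $\alpha_0(\mathcal C')=\beta_1(\mathcal C')$ for every minor $\mathcal C'$ of $\mathcal C$. *)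

(* Defs.v *)
From HB Require Import structures.
From mathcomp Require Import all_boot all_order all_algebra.
From mathcomp Require Import mpoly.

Set Implicit Arguments.
Unset Strict Implicit.
Unset Printing Implicit Defensive.

Import GRing.Theory.
Local Open Scope ring_scope.

(* Ideals and other subsets of a ring are Prop-valued predicates, compared
   extensionally: membership in them need not be decidable. *)

Section RingNotions.
Variable R : comNzRingType.
Implicit Types (G I J P : R -> Prop) (f : R).

Definition subset_of I J : Prop := forall f, I f -> J f.

Definition ideal_gen G f : Prop :=
  exists2 s : seq (R * R),
    (forall p, p \in s -> G p.2) & f = \sum_(p <- s) p.1 * p.2.

Definition ideal_mul I J : R -> Prop :=
  ideal_gen (fun h => exists f g, [/\ I f, J g & h = f * g]).

Fixpoint ideal_exp I k : R -> Prop :=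
  if k is k'.+1 then ideal_mul I (ideal_exp I k') else fun=> True.

(* f satisfies f^k + a_1 f^(k-1) + ... + a_k = 0 with a_i in I^i, k >= 1 *)
Definition integral_closure I f : Prop :=
  exists k (a : nat -> R),
    [/\ (0 < k)%N,
        forall i, (1 <= i <= k)%N -> ideal_exp I i (a i)
      & f ^+ k + \sum_(1 <= i < k.+1) a i * f ^+ (k - i) = 0].

Definition is_ideal I : Prop :=
  [/\ I 0, forall f g, I f -> I g -> I (f + g)
    & forall f g, I g -> I (f * g)].

Definition prime_ideal P : Prop :=
  [/\ is_ideal P, ~ P 1 & forall f g, P (f * g) -> P f \/ P g].

(* there is a chain of primes P_0 < P_1 < ... < P_k = P *)
Definition prime_height_ge P k : Prop :=
  exists Q : nat -> R -> Prop,
    [/\ forall i, (i <= k)%N -> prime_ideal (Q i),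
        forall i, (i < k)%N ->
          subset_of (Q i) (Q i.+1) /\ ~ subset_of (Q i.+1) (Q i)
      & forall f, Q k f <-> P f].

(* the minimum of the heights of the primes containing I is exactly g *)
Definition has_height I g : Prop :=
  (forall P, prime_ideal P -> subset_of I P -> prime_height_ge P g) /\
  (exists P, [/\ prime_ideal P, subset_of I P & ~ prime_height_ge P g.+1]).

End RingNotions.

Section Clutters.
Variable T : finType.
Implicit Types (V A : {set T}) (E M : {set {set T}}).

Definition clutter E : Prop :=
  forall S S', S \in E -> S' \in E -> S \subset S' -> S = S'.

Definition vertex_cover V E A : bool :=
  (A \subset V) && [forall S in E, A :&: S != set0].

(* The default V of arg min is itself a vertex cover as soon as the edges are
   nonempty subsets of V. *)
Definition alpha0 V E : nat :=
  #|[arg min_(A < V | vertex_cover V E A) #|A|]|.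

Definition beta1 E : nat :=
  \max_(M : {set {set T}} | (M \subset E) && trivIset M) #|M|.

End Clutters.

Section EdgeIdeals.
Variables (K : fieldType) (n : nat).
Implicit Types (E : {set {set 'I_n}}) (Y Z V S : {set 'I_n}).
Implicit Types (f : {mpoly K[n]}) (m : 'X_{1..n}).

Definition edge_mnm S : 'X_{1..n} := [multinom ((i \in S) : nat) | i < n].

Definition edge_ideal E : {mpoly K[n]} -> Prop :=
  ideal_gen (fun h => exists2 S, S \in E & h = 'X_[edge_mnm S]).

(* K[V], as a subring of K[x_1, ..., x_n] *)
Definition poly_in V f : Prop :=
  forall m, m \in msupp f -> forall i, m i != 0%N -> i \in V.

Definition minor_vertices Y Z : {set 'I_n} := ~: (Y :|: Z).

Definition minor_subst Y Z f : {mpoly K[n]} :=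
  f \mPo [tuple (if i \in Y then 0 else if i \in Z then 1 else 'X_i) | i < n].

(* The substitution is a ring morphism onto K[minor_vertices Y Z], hence the
   image of an ideal is an ideal of that subring. *)
Definition minor_ideal Y Z (I : {mpoly K[n]} -> Prop) f : Prop :=
  exists2 h, I h & f = minor_subst Y Z h.

Definition min_monomial (I : {mpoly K[n]} -> Prop) m : Prop :=
  I 'X_[m] /\ forall m', (m' <= m)%MM -> I 'X_[m'] -> m' = m.

Definition mnm_supp m : {set 'I_n} := [set i | m i != 0%N].

(* E' is the edge set of the minor of E given by Y and Z; its vertex set is
   minor_vertices Y Z. *)
Definition is_minor E Y Z E' : Prop :=
  let I' := minor_ideal Y Z (edge_ideal E) in
  [/\ [disjoint Y & Z],
      exists2 f, I' f & f != 0,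
      exists2 f, poly_in (minor_vertices Y Z) f & ~ I' f
    & forall S, S \in E' <-> exists2 m, min_monomial I' m & S = mnm_supp m].

Definition packing_property E : Prop :=
  forall Y Z E', is_minor E Y Z E' ->
    alpha0 (minor_vertices Y Z) E' = beta1 E'.

End EdgeIdeals.

(* Main.v *)
Require Import Defs.
From HB Require Import structures.
From mathcomp Require Import all_boot all_order all_algebra.
From mathcomp Require Import mpoly.

Set Implicit Arguments.
Unset Strict Implicit.
Unset Printing Implicit Defensive.

Import GRing.Theory.
Local Open Scope ring_scope.

(** The inclusion of an ideal [J] in its integral closure is the equation
[f - f = 0].  Conversely, let [I] be the edge ideal of [C] and let [f] be
integral over [I ^ 2].

A vertex cover [A] of [C] defines a monomial valuation, which sends a polynomial
to the least number of variables of [A], with multiplicity, in one of its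
monomials.  It is at least 1 on [I], so at least 2 on [I ^ 2], and integral
dependence cannot lower it; hence every monomial [x^m] of [f] has
[weight A m >= 2] for every cover [A] (integral_closure_weight).

It remains to see that such an [x^m] is a multiple of [x^S1 x^S2] for two edges
[S1] and [S2] (packing_edge_pair), and for this a single minor is enough: put
the variables of exponent 0 in [x^m] equal to 0, and those of exponent at least
2 equal to 1.  All remaining vertices have exponent 1, so a vertex cover of the
minor, extended by the deleted vertices, is a cover of [C] whose weight is its
cardinality: covers of the minor have at least two elements.  By packing, the
minor has two disjoint edges.  They come from edges [S1], [S2] of [C] that avoid
the exponents 0 and meet only where the exponent is at least 2, which is exactly
what makes [x^S1 x^S2] divide [x^m].  The minor degenerates only when an edge
[S] of [C] lies within the exponents at least 2, and then [(x^S)^2] divides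
[x^m]. *)

(** * Ideals and divisibility *)

Section Ideals.
Variable R : comNzRingType.
Implicit Types (G I J : R -> Prop) (f : R).

Lemma mem_ideal_gen G f : G f -> ideal_gen G f.
Proof.
move=> Gf; exists [:: (1, f)]; last by rewrite big_seq1 mul1r.
by move=> p; rewrite inE => /eqP ->.
Qed.

Lemma ideal_genP G : is_ideal (ideal_gen G).
Proof.
split.
- by exists [::]; rewrite ?big_nil.
- move=> _ _ [s sG ->] [t tG ->]; exists (s ++ t); last by rewrite big_cat.
  by move=> p; rewrite mem_cat => /orP[/sG|/tG].
- move=> f _ [s sG ->]; exists [seq (f * p.1, p.2) | p <- s].
    by move=> _ /mapP[p /sG Gp ->].
  by rewrite big_map mulr_sumr; apply: eq_bigr => p _; rewrite mulrA.
Qed.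

Lemma ideal_sum J (A : eqType) (r : seq A) (F : A -> R) :
  is_ideal J -> (forall a, a \in r -> J (F a)) -> J (\sum_(a <- r) F a).
Proof.
case=> J0 JD _; elim: r => [|a r IH] JF; first by rewrite big_nil.
rewrite big_cons; apply: JD; first by apply: JF; rewrite mem_head.
by apply: IH => b br; apply: JF; rewrite inE br orbT.
Qed.

Lemma ideal_gen_min G J :
  is_ideal J -> subset_of G J -> subset_of (ideal_gen G) J.
Proof.
move=> idJ GJ _ [s sG ->]; apply: ideal_sum => // p /sG /GJ Jp.
by case: idJ => _ _; apply.
Qed.

Lemma sub_integral_closure J : subset_of J (integral_closure J).
Proof.
move=> f Jf; exists 1%N, (fun=> - f); split=> //.
  move=> i; rewrite -eqn_leq => /eqP <- /=; apply: mem_ideal_gen.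
  by exists f, (-1); split=> //; rewrite mulrN1.
by rewrite big_nat1 subnn expr0 mulr1 expr1 subrr.
Qed.

(** Divisibility of the image by a fixed element is stated as membership in an
ideal, so that it propagates from generators by ideal_gen_min and ideal_sum. *)
Lemma preim_principal_ideal (S : comNzRingType) (phi : {rmorphism R -> S})
    (t : S) :
  is_ideal (fun f => exists q, phi f = t * q).
Proof.
split=> [|f g [q qE] [r rE]|f g [q qE]].
- by exists 0; rewrite rmorph0 mulr0.
- by exists (q + r); rewrite rmorphD qE rE mulrDr.
- by exists (phi f * q); rewrite rmorphM qE mulrCA.
Qed.

Lemma ideal_exp_dvd (S : comNzRingType) (phi : {rmorphism R -> S}) (t : S) I k :
  (forall f, I f -> exists q, phi f = t * q) ->
  forall f, ideal_exp I k f -> exists q, phi f = t ^+ k * q.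
Proof.
move=> It; elim: k => [|k IH] /=.
  by move=> f _; exists (phi f); rewrite mul1r.
apply: ideal_gen_min; first exact: preim_principal_ideal.
move=> _ [f [g [/It[q qE] /IH[r rE] ->]]]; exists (q * r).
by rewrite rmorphM qE rE exprS mulrACA.
Qed.

End Ideals.

(** This is integral closedness of the order filtration of [D[X]], proved without
fractions or valuations.  If [phi f = X^d q] with [d < k], every term but the
first of the integral equation is divisible by [X^(d N + 1)]; dividing by
[X^(d N)] and evaluating at 0 gives [q(0)^N = 0], so one more factor [X] can be
extracted. *)
Lemma integral_closure_order (R : comNzRingType) (D : idomainType)
    (phi : {rmorphism R -> {poly D}}) (J : R -> Prop) k :
  (forall f, J f -> exists q, phi f = 'X^k * q) ->
  forall f, integral_closure J f -> exists q, phi f = 'X^k * q.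
Proof.
move=> Jk f [N [a [N_gt0 Ja eqf]]].
suff: forall d, (d <= k)%N -> exists q, phi f = 'X^d * q by apply.
elim=> [|d IH] ltdk; first by exists (phi f); rewrite mul1r.
have [q qE] := IH (ltnW ltdk).
have [r rE]: exists r,
    phi (\sum_(1 <= i < N.+1) a i * f ^+ (N - i)) = 'X^((d * N).+1) * r.
  apply: (ideal_sum (preim_principal_ideal _ _)) => i.
  rewrite mem_index_iota ltnS => /andP[i_gt0 leiN].
  have [b bE] : exists b, phi (a i) = 'X^k ^+ i * b.
    by apply: (ideal_exp_dvd Jk); apply: Ja; rewrite i_gt0.
  have le_e : ((d * N).+1 <= k * i + d * (N - i))%N.
    rewrite -{1}(subnK leiN) mulnDr addnC -addSn leq_add2r.
    by rewrite ltn_mul2r i_gt0.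
  exists ('X^(k * i + d * (N - i) - (d * N).+1) * (b * q ^+ (N - i))).
  rewrite [RHS]mulrA -exprD subnKC // rmorphM rmorphXn /= bE qE exprMn -!exprM.
  by rewrite mulrACA -exprD.
have /eqP : 'X^(d * N) * (q ^+ N + 'X * r) = 0.
  move/(congr1 phi): eqf; rewrite rmorph0 rmorphD rmorphXn /= rE qE => <-.
  by rewrite exprMn -exprM mulrDr mulrA -exprSr.
rewrite mulf_eq0 expf_eq0 polyX_eq0 andbF /= => /eqP/(congr1 (horner^~ 0)).
rewrite !hornerE => /eqP; rewrite expf_eq0 N_gt0 /= => q0.
have /factor_theorem[q' q'E] : root q 0 by [].
by exists q'; rewrite qE q'E polyC0 subr0 exprSr -mulrA ['X * _]mulrC.
Qed.

(** * Weights of monomials *)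

Section Weights.
Variables (K : fieldType) (n : nat).
Implicit Types (A S Y Z : {set 'I_n}) (C : {set {set 'I_n}}) (m : 'X_{1..n}).
Implicit Types (f : {mpoly K[n]}).

Definition weight A m : nat := \sum_(i in A) m i.

(** The morphism [x_i |-> x_i t] for [i] in [A], [x_i |-> x_i] otherwise: the
order in [t] of the image is the valuation attached to [A]. *)
Definition weight_grading A : {mpoly K[n]} -> {poly {mpoly K[n]}} :=
  mmap (polyC \o @mpolyC n K) (fun i => ('X_i)%:P * 'X^(i \in A)).

HB.instance Definition _ A := GRing.RMorphism.on (weight_grading A).

Lemma weight_gradingX A m :
  weight_grading A 'X_[m] = ('X_[m])%:P * 'X^(weight A m).
Proof.
rewrite /weight_grading mmapX /mmap1 [X in X%:P]mpolyXE_id rmorph_prod /=.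
rewrite /weight -prodrXr [X in _ * X]big_mkcond -big_split /=.
apply: eq_bigr => i _; rewrite exprMn rmorphXn /=.
by case: (i \in A); rewrite ?expr1 // expr0 expr1n.
Qed.

(** A term of [f] is only multiplied by a power of [t], so distinct terms cannot
cancel in the image, even when they have the same weight. *)
Lemma coef_weight_grading A f m : (weight_grading A f)`_(weight A m)@_m = f@_m.
Proof.
rewrite [in RHS](mpolyE f) {1}[f]mpolyE (rmorph_sum (weight_grading A)) /=.
rewrite coef_sum !(raddf_sum (mcoeff m)) /=.
apply: eq_bigr => m' _; rewrite -mul_mpolyC rmorphM /= weight_gradingX.
rewrite /weight_grading mmapC /= mulrA -polyCM coefMXn coefC.
rewrite mul_mpolyC mcoeffZ mcoeffX.
have [<-|ne_m] := eqVneq m' m.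
  by rewrite ltnn subnn eqxx mcoeffZ mcoeffX eqxx.
case: ifP => _; first by rewrite mcoeff0 mulr0.
by case: ifP => _; rewrite /= mulr0 ?mcoeff0 // mcoeffZ mcoeffX (negPf ne_m)
  mulr0.
Qed.

Lemma integral_closure_weight A C k f :
  (forall S, S \in C -> (0 < weight A (edge_mnm S))%N) ->
  integral_closure (ideal_exp (edge_ideal C) k) f ->
  forall m, m \in msupp f -> (k <= weight A m)%N.
Proof.
move=> Cpos fI m; apply: contraLR; rewrite -ltnNge => lt_mk.
rewrite mcoeff_msupp negbK -(coef_weight_grading A).
suff [q ->] : exists q, weight_grading A f = 'X^k * q.
  by rewrite coefXnM lt_mk mcoeff0.
apply: integral_closure_order fI; apply: ideal_exp_dvd.
apply: ideal_gen_min; first exact: preim_principal_ideal.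
move=> _ [S SC ->].
exists (('X_[edge_mnm S])%:P * 'X^((weight A (edge_mnm S)).-1)).
by rewrite [LHS]weight_gradingX mulrCA -exprS prednK // Cpos.
Qed.

Lemma weight_edge A S : weight A (edge_mnm S) = #|A :&: S|.
Proof.
rewrite -sum1_card [RHS](eq_bigl (fun i => (i \in A) && (i \in S))); last first.
  by move=> i; rewrite inE.
by rewrite big_mkcondr; apply: eq_bigr => i _; rewrite mnmE; case: (i \in S).
Qed.

Lemma mnm_supp_edge S : mnm_supp (edge_mnm S) = S.
Proof. by apply/setP => i; rewrite inE mnmE; case: (i \in S). Qed.

Lemma edge_mnm_le S m : (edge_mnm S <= m)%MM = (S \subset mnm_supp m).
Proof.
apply/mnm_lepP/subsetP => [leSm i iS|subSm i].
  by have := leSm i; rewrite inE mnmE iS lt0n.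
by rewrite mnmE; case: (boolP (i \in S)) => // /subSm; rewrite inE lt0n.
Qed.

(** * The minor *)

(** Every monomial ideal has this form; it is used to bound the supports of the
elements of the minor ideal from those of its generators. *)
Lemma monomial_ideal (D : 'X_{1..n} -> Prop) :
  (forall m m', (m <= m')%MM -> D m -> D m') ->
  is_ideal (fun f => forall m, m \in msupp f -> D m).
Proof.
move=> upD; split=> [m|f g fD gD m|f g gD m].
- by rewrite msupp0.
- by move/msuppD_le; rewrite mem_cat => /orP[/fD|/gD].
- move/msuppM_le/allpairsP => [[m1 m2] /= [_ /gD Dm2 ->]].
  by apply: upD Dm2; apply: lem_addl.
Qed.

Lemma minor_substX Y Z S : [disjoint Y & Z] ->
  minor_subst Y Z 'X_[edge_mnm S] =
    (if [disjoint S & Y] then 'X_[edge_mnm (S :\: Z)] else 0) :> {mpoly K[n]}.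
Proof.
move=> disYZ; rewrite /minor_subst comp_mpolyX.
case: ifPn => [disSY|].
  rewrite mpolyXE_id; apply: eq_bigr => i _; rewrite tnth_mktuple !mnmE inE.
  case: (boolP (i \in S)) => iS; last by rewrite andbF !expr0.
  rewrite (disjointFr disSY iS); case: ifP => _; last by rewrite expr1.
  by rewrite expr1n expr0.
rewrite -setI_eq0 => /set0Pn[i /setIP[iS iY]].
by rewrite (bigD1 i) //= tnth_mktuple mnmE iS iY expr1 mul0r.
Qed.

(** Supports of the nonzero images of the generators under the substitution; they
generate the minor ideal but need not be minimal. *)
Definition minor_traces C Y Z : {set {set 'I_n}} :=
  [set S :\: Z | S in [set S in C | [disjoint S & Y]]].

Definition minor_edges C Y Z : {set {set 'I_n}} :=
  [set B | minset (fun B => B \in minor_traces C Y Z) B].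

Lemma minor_tracesP C Y Z B :
  reflect (exists S, [/\ S \in C, [disjoint S & Y] & B = S :\: Z])
          (B \in minor_traces C Y Z).
Proof.
apply: (iffP imsetP) => [[S]|[S [SC SY ->]]].
  by rewrite inE => /andP[SC SY ->]; exists S.
by exists S => //; rewrite inE SC.
Qed.

Lemma minor_traces_vertices C Y Z B :
  B \in minor_traces C Y Z -> B \subset minor_vertices Y Z.
Proof.
case/minor_tracesP => S [_ disSY ->]; apply/subsetP => i.
by rewrite !inE => /andP[/negPf -> iS]; rewrite (disjointFr disSY iS).
Qed.

Lemma minor_ideal_monomial C Y Z B : [disjoint Y & Z] ->
  B \in minor_traces C Y Z ->
  minor_ideal Y Z (@edge_ideal K n C) 'X_[edge_mnm B].
Proof.
move=> disYZ /minor_tracesP[S [SC disSY ->]]; exists 'X_[edge_mnm S].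
  by apply: mem_ideal_gen; exists S.
by rewrite minor_substX // disSY.
Qed.

Lemma minor_ideal_support C Y Z f : [disjoint Y & Z] ->
  minor_ideal Y Z (@edge_ideal K n C) f ->
  forall m, m \in msupp f ->
    exists2 B, B \in minor_traces C Y Z & B \subset mnm_supp m.
Proof.
move=> disYZ [h [s sC ->] ->].
have idJ : is_ideal (fun f : {mpoly K[n]} => forall m, m \in msupp f ->
    exists2 B, B \in minor_traces C Y Z & B \subset mnm_supp m).
  apply: monomial_ideal => m m' lemm' [B BC Bm]; exists B => //.
  by rewrite -edge_mnm_le; apply: lepm_trans lemm'; rewrite edge_mnm_le.
rewrite /minor_subst rmorph_sum; apply: (ideal_sum idJ) => p /sC[S SC ->].
rewrite rmorphM; case: idJ => _ _; apply => m.
have := minor_substX S disYZ; rewrite /minor_subst /= => ->.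
case: ifP => disSY; last by rewrite msupp0.
rewrite msuppX inE => /eqP ->; exists (S :\: Z); last by rewrite mnm_supp_edge.
by apply/minor_tracesP; exists S.
Qed.

(** The two hypotheses on the traces say that the minor ideal is neither zero nor
the whole ring. *)
Lemma minor_edgesP C Y Z : [disjoint Y & Z] ->
  minor_traces C Y Z != set0 -> set0 \notin minor_traces C Y Z ->
  is_minor K C Y Z (minor_edges C Y Z).
Proof.
move=> disYZ /set0Pn[B0 B0C] no0.
have ltX m : minor_ideal Y Z (@edge_ideal K n C) 'X_[m] ->
    exists2 B, B \in minor_traces C Y Z & B \subset mnm_supp m.
  by move/(minor_ideal_support disYZ); apply; rewrite msuppX mem_head.
split=> //.
- exists 'X_[edge_mnm B0]; first exact: minor_ideal_monomial.
  by apply/negP => /eqP/(congr1 (mcoeff (edge_mnm B0)))/eqP;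
    rewrite mcoeffX eqxx mcoeff0 oner_eq0.
- exists 'X_[0%MM] => [m|/ltX[B BC]].
    by rewrite msuppX inE => /eqP -> i; rewrite mnm0E.
  suff -> : mnm_supp 0%MM = set0 :> {set 'I_n}.
    by rewrite subset0 => /eqP B_0; rewrite -B_0 BC in no0.
  by apply/setP => i; rewrite !inE mnm0E.
move=> S; rewrite inE; split=> [/minsetP[SC minS]|[m [Im minm] ->]].
  exists (edge_mnm S); last by rewrite mnm_supp_edge.
  split=> [|m lemS /ltX[B BC Bm]]; first exact: minor_ideal_monomial.
  have subm : mnm_supp m \subset S.
    apply/subsetP => i; rewrite inE; have /mnm_lepP/(_ i) := lemS.
    by rewrite mnmE; case: (i \in S) => //; rewrite leqn0 => ->.
  have BS := minS _ BC (subset_trans Bm subm).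
  have leSm : (edge_mnm S <= m)%MM by rewrite edge_mnm_le -BS.
  apply/mnmP => i; apply/eqP.
  by rewrite eqn_leq (mnm_lepP lemS) (mnm_lepP leSm).
have [B BC Bm] := ltX _ Im.
have eqm B' : B' \in minor_traces C Y Z -> B' \subset mnm_supp m ->
    edge_mnm B' = m.
  move=> B'C B'm; apply: minm; first by rewrite edge_mnm_le.
  exact: minor_ideal_monomial.
apply/minsetP; split=> [|B' B'C B'm].
  by rewrite -(eqm B) // mnm_supp_edge.
by rewrite -(eqm B') // mnm_supp_edge.
Qed.

Lemma sub_minor_edges C Y Z : minor_edges C Y Z \subset minor_traces C Y Z.
Proof. by apply/subsetP => B; rewrite inE => /minsetp. Qed.

(** The hypothesis makes [V] itself a cover; if there were none, alpha0 would be
the cardinality of its default value [V], attained by no cover. *)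
Lemma alpha0_cover (V : {set 'I_n}) C :
  (forall S, S \in C -> S \subset V /\ S != set0) ->
  exists2 A, vertex_cover V C A & #|A| = alpha0 V C.
Proof.
move=> CV; rewrite /alpha0; case: arg_minnP => [|A covA _]; last by exists A.
rewrite /vertex_cover subxx; apply/forall_inP => S /CV[/setIidPr -> //].
Qed.

Lemma beta1_gt1 C : (1 < beta1 C)%N ->
  exists B1 B2, [/\ B1 \in C, B2 \in C & [disjoint B1 & B2]].
Proof.
have [|M /andP[MC trivM] maxM] := @eq_bigmax_cond _
    [pred M : {set {set 'I_n}} | (M \subset C) && trivIset M] (fun M => #|M|).
  apply/card_gt0P; exists set0; rewrite inE sub0set; apply/trivIsetP => B1 B2.
  by rewrite inE.
rewrite (maxM : beta1 C = _) => /card_gt1P[B1 [B2 [B1M B2M neB]]]; exists B1, B2.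
by rewrite !(subsetP MC) //; split=> //; apply: (trivIsetP trivM).
Qed.

(** An edge of [C] that misses [Y] leaves a trace, hence contains a minimal one,
which [A] meets. *)
Lemma minor_cover C Y Z A :
  vertex_cover (minor_vertices Y Z) (minor_edges C Y Z) A ->
  forall S, S \in C -> (A :|: Y) :&: S != set0.
Proof.
case/andP => _ /forall_inP covA S SC.
have [disSY|] := boolP [disjoint S & Y]; last first.
  by rewrite -setI_eq0 setIC setIUl setU_eq0 negb_and orbC => ->.
have [B minB BS] : {B | minset (fun B => B \in minor_traces C Y Z) B
                       & B \subset S :\: Z}.
  by apply: minset_exists; apply/minor_tracesP; exists S.
have /set0Pn[i /setIP[iA iB]] : A :&: B != set0 by apply: covA; rewrite inE.
apply/set0Pn; exists i; rewrite !inE iA /=.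
by have := subsetP BS _ iB; rewrite inE => /andP[].
Qed.

(** The hypothesis says that [x^m] lies in the second symbolic power of the edge
ideal. *)
Lemma packing_edge_pair C m : packing_property K C ->
  (forall A, (forall S, S \in C -> A :&: S != set0) -> (1 < weight A m)%N) ->
  exists S1 S2, [/\ S1 \in C, S2 \in C & (edge_mnm S1 + edge_mnm S2 <= m)%MM].
Proof.
move=> packC covC.
pose Y := [set i | m i == 0%N]; pose Z := [set i | 1 < m i]%N.
have disYZ : [disjoint Y & Z].
  by apply/pred0P => i /=; rewrite !inE; case: (m i).
have wY : weight Y m = 0%N by apply: big1 => i; rewrite inE => /eqP.
have lem S1 S2 : [disjoint S1 & Y] -> [disjoint S2 & Y] ->
    [disjoint S1 :\: Z & S2 :\: Z] -> (edge_mnm S1 + edge_mnm S2 <= m)%MM.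
  move=> dis1 dis2 /pred0P dis12; apply/mnm_lepP => i; rewrite mnmDE !mnmE.
  have := dis12 i; rewrite /= !inE.
  case: (boolP (i \in S1)) => [/(disjointFr dis1)|_];
    case: (boolP (i \in S2)) => [/(disjointFr dis2)|_]; rewrite ?inE //;
    by case: (m i) => [|[|]].
(* If the minor ideal is the whole ring, some edge lies in [Z]; it serves twice. *)
have [/minor_tracesP[S [SC disSY S0]]|no0] :=
  boolP (set0 \in minor_traces C Y Z).
  by exists S, S; rewrite SC lem // -S0 -setI_eq0 set0I.
(* If every edge of [C] met [Y], then [Y], of weight 0, would be a cover. *)
have Cn0 : minor_traces C Y Z != set0.
  apply/set0Pn; have [/exists_inP[S SC disSY]|noS] :=
      boolP [exists S in C, [disjoint S & Y]].
    by exists (S :\: Z); apply/minor_tracesP; exists S.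
  suff: (1 < weight Y m)%N by rewrite wY.
  apply: covC => S SC.
  apply: contraNneq noS => SY; apply/exists_inP; exists S => //.
  by rewrite disjoint_sym -setI_eq0 SY.
have traceV B : B \in minor_edges C Y Z ->
    B \subset minor_vertices Y Z /\ B != set0.
  move/(subsetP (sub_minor_edges _ _ _)) => BC.
  by split; [apply: minor_traces_vertices BC|apply: contraNneq no0 => <-].
have [A covA cardA] := alpha0_cover traceV.
have : (1 < beta1 (minor_edges C Y Z))%N.
  rewrite -(packC _ _ _ (minor_edgesP disYZ Cn0 no0)) -cardA.
  apply: leq_trans (covC _ (minor_cover covA)) _.
  have AV : A \subset minor_vertices Y Z by case/andP: covA.
  (* The exponents are 1 on [A], which lies off [Y] and [Z], and 0 on [Y]. *)
  rewrite /weight -sum1_card big_mkcond [leqRHS]big_mkcond.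
  apply: leq_sum => i _; rewrite inE; have [iA|_] /= := boolP (i \in A).
    by have := subsetP AV _ iA; rewrite !inE => /norP[_]; rewrite -leqNgt.
  by rewrite inE; case: eqP => [->|].
case/beta1_gt1 => B1 [B2 [B1C B2C disB]].
have /minor_tracesP[S1 [S1C dis1 B1E]] := subsetP (sub_minor_edges _ _ _) _ B1C.
have /minor_tracesP[S2 [S2C dis2 B2E]] := subsetP (sub_minor_edges _ _ _) _ B2C.
by exists S1, S2; rewrite S1C S2C lem // -B1E -B2E.
Qed.

Lemma edge_square_monomials C f :
  (forall m, m \in msupp f -> exists S1 S2,
     [/\ S1 \in C, S2 \in C & (edge_mnm S1 + edge_mnm S2 <= m)%MM]) ->
  ideal_exp (@edge_ideal K n C) 2 f.
Proof.
move=> supp_f; rewrite [f]mpolyE /=; apply: ideal_sum; first exact: ideal_genP.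
move=> m /supp_f[S1 [S2 [S1C S2C /submK <-]]].
have [_ _ absorb] := ideal_genP (fun h : {mpoly K[n]} => exists f g,
  [/\ edge_ideal C f, ideal_mul (edge_ideal C) (fun=> True) g & h = f * g]).
rewrite -mul_mpolyC mpolyXD mulrA; apply/absorb/mem_ideal_gen.
have edgeX S : S \in C -> @edge_ideal K n C 'X_[edge_mnm S].
  by move=> SC; apply: mem_ideal_gen; exists S.
exists 'X_[edge_mnm S1], 'X_[edge_mnm S2]; split; first exact: edgeX.
  apply: mem_ideal_gen; exists 'X_[edge_mnm S2], 1.
  by split; [apply: edgeX | | rewrite mulr1].
by rewrite mpolyXD.
Qed.

End Weights.

Unset Implicit Arguments.

Theorem proposition4p29 (K : fieldType) (n g : nat) (C : {set {set 'I_n}})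
  (hC : clutter C)
  (hg : has_height (@edge_ideal K n C) g) (hg2 : (2 <= g)%N)
  (hdeg : forall S, S \in C -> (2 <= mdeg (edge_mnm S))%N)
  (hvar : forall i : 'I_n, exists2 S, S \in C & (U_(i) <= edge_mnm S)%MM)
  (hpack : packing_property K C) :
  forall f : {mpoly K[n]},
    ideal_exp (edge_ideal C) 2 f <->
    integral_closure (ideal_exp (edge_ideal C) 2) f.
Proof.
move=> f; split; first exact: sub_integral_closure.
move=> fI; apply: edge_square_monomials => m mf.
apply: (packing_edge_pair hpack) => A covA.
apply: integral_closure_weight fI m mf => S SC.
by rewrite weight_edge card_gt0 covA.
Qed.
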